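(* Assume the continuum hypothesis. Let $X$ be a Polish topological vector space (over $\mathbb{R}$), and let $(X,\mathcal{C})$ be a perfect translation base which satisfies the countable chain condition, where $\mathcal{C}$ is linearly invariant and $\operatorname{card}(\mathcal{C})\le 2^{\aleph_0}$. Then there exist two sets $T,T'\subseteq X$ such that (i) both $T$ and $T'$ are rare sets in $(X,\mathcal{C})$; (ii) their sum $T+T'=\{a+b:a\in T,\ b\in T'\}$ is a Bernstein set in $X$; (iii) $T$ and $T'$ are both meager in every perfect translation base $(X,\mathcal{D})$ that is non-equivalent to $(X,\mathcal{C})$.
   Context: A category base is a pair $(X,\mathcal{C})$ with $X$ a nonempty set and $\mathcal{C}$ a family of subsets of $X$ whose nonempty members (called regions) satisfy: (1) $X=\bigcup\mathcal{C}$; (2) for every region $A$ and every nonempty family $\mathcal{D}$ of pairwise disjoint regions with $\operatorname{card}(\mathcal{D})<\operatorname{card}(\mathcal{C})$: (i) if $A\cap\bigcup\mathcal{D}$ contains a region, then there is $D\in\mathcal{D}$ such that $A\cap D$ contains a region; (ii) if $A\cap\bigcup\mathcal{D}$ contains no region, then there is a region $B\subseteq A$ disjoint from every region in $\mathcal{D}$. A set $S\subseteq X$ is singular if every region contains a subregion disjoint from $S$; a set is meager if it is a countable union of singular sets, and abundant otherwise. A set $E$ is a Baire set if every region contains a subregion in which $E$ or its complement is meager (i.e. whose intersection with $E$, resp. with $X\setminus E$, is meager). Let $\mathcal{M}(\mathcal{C})$ and $\mathcal{B}(\mathcal{C})$ be the classes of meager and Baire sets. Two category bases $(X,\mathcal{C})$,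 $(X,\mathcal{D})$ are equivalent if $\mathcal{M}(\mathcal{C})=\mathcal{M}(\mathcal{D})$ and $\mathcal{B}(\mathcal{C})=\mathcal{B}(\mathcal{D})$. A perfect base on $X$ is a category base in which every region is a perfect subset of $X$ and, for every region $A$ and every $x\in A$, there is a descending sequence $A_1\supseteq A_2\supseteq\cdots$ of regions with $x\in A_n$ and $\operatorname{diam}(A_n)\le 1/n$ (w.r.t. a compatible complete metric). A perfect translation base is a perfect base $(X,\mathcal{C})$ such that $\mathcal{C}$ is translation invariant ($E\in\mathcal{C}$, $r\in X$ imply $E+r\in\mathcal{C}$) and, for every region $A$ and every countable dense set $D\subseteq X$, the set $\bigcup_{r\in D}(A+r)$ is abundant everywhere (its intersection with every region is abundant). The base satisfies the countable chain condition if every family of pairwise disjoint regions is at most countable. $\mathcal{C}$ is linearly invariant if it is translation invariant and $\lambda E\in\mathcal{C}$ for every $E\in\mathcal{C}$ and every nonzero scalar $\lambda$. A set $R$ is rare in $(X,\mathcal{C})$ if $R$ is uncountable and $R\cap M$ is countable for every meager set $M$ of $(X,\mathcal{C})$. A Bernstein set in $X$ is a set $B\subseteq X$ such that $B\cap P\neq\emptyset$ and $(X\setminus B)\cap P\neq\emptyset$ for every nonempty perfect set $P\subseteq X$. *)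

(* Defs.v *)
From HB Require Import structures.
From mathcomp Require Import all_boot all_order all_algebra.
From mathcomp Require Import all_classical all_reals.
From mathcomp Require Import topology tvs.
Set Implicit Arguments. Unset Strict Implicit. Unset Printing Implicit Defensive.
Import Order.TTheory GRing.Theory Num.Theory.
Local Open Scope classical_set_scope.
Local Open Scope ring_scope.

Definition CH : Prop :=
  forall S : set (set nat), countable S \/ card_eq S [set: set nat].

Definition card_lt T U (A : set T) (B : set U) : Prop :=
  card_le A B /\ ~ card_le B A.

Section Metric.
Variables (R : realType) (X : topologicalType) (d : X -> X -> R).

Definition is_metric : Prop :=
  [/\ forall x y, d x y = 0 <-> x = y,
      forall x y, d x y = d y x &
      forall x y z, d x z <= d x y + d y z].

Definition metric_compatible : Prop :=
  forall A : set X, open A <->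
    (forall x, A x -> exists2 e : R, 0 < e & [set y | d x y < e] `<=` A).

Definition metric_complete : Prop :=
  forall u : nat -> X,
    (forall e : R, 0 < e -> exists N, forall m n, (N <= m)%N -> (N <= n)%N ->
        d (u m) (u n) < e) ->
    exists l, forall e : R, 0 < e -> exists N, forall n, (N <= n)%N -> d (u n) l < e.

Definition separable_space : Prop := exists D : set X, countable D /\ dense D.

Definition diam_le (A : set X) (r : R) : Prop :=
  forall x y, A x -> A y -> d x y <= r.
End Metric.

Section CategoryBase.
Variables (X : Type) (C : set (set X)).

Definition region (A : set X) : Prop := C A /\ A !=set0.

Definition contains_region (S : set X) : Prop :=
  exists B, region B /\ B `<=` S.

Definition pairwise_disjoint (D : set (set X)) : Prop :=
  forall D1 D2, D D1 -> D D2 -> D1 <> D2 -> D1 `&` D2 = set0.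

Definition category_base : Prop :=
  (\bigcup_(A in C) A = [set: X]) /\
  forall A (D : set (set X)),
    region A -> D !=set0 -> D `<=` region -> pairwise_disjoint D ->
    card_lt D C ->
    (contains_region (A `&` \bigcup_(E in D) E) ->
       exists2 E, D E & contains_region (A `&` E)) /\
    (~ contains_region (A `&` \bigcup_(E in D) E) ->
       exists B, [/\ region B, B `<=` A & forall E, D E -> B `&` E = set0]).

Definition singular (S : set X) : Prop :=
  forall A, region A -> exists B, [/\ region B, B `<=` A & B `&` S = set0].

Definition meager (S : set X) : Prop :=
  exists F : nat -> set X, (forall n, singular (F n)) /\ S = \bigcup_n F n.

Definition abundant (S : set X) : Prop := ~ meager S.

Definition abundant_everywhere (S : set X) : Prop :=
  forall A, region A -> abundant (A `&` S).

Definition baire_set (E : set X) : Prop :=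
  forall A, region A -> exists B, [/\ region B, B `<=` A &
    meager (B `&` E) \/ meager (B `&` ~` E)].

Definition ccc : Prop :=
  forall D : set (set X), D `<=` region -> pairwise_disjoint D -> countable D.

Definition rare (S : set X) : Prop :=
  ~ countable S /\ forall M, meager M -> countable (S `&` M).
End CategoryBase.

Definition equivalent_bases (X : Type) (C D : set (set X)) : Prop :=
  (forall S, meager C S <-> meager D S) /\
  (forall S, baire_set C S <-> baire_set D S).

Section Vector.
Variables (R : realType) (X : topologicalLmodType R) (d : X -> X -> R).

Definition translate (E : set X) (r : X) : set X := [set x + r | x in E].
Definition dilate (l : R) (E : set X) : set X := [set l *: x | x in E].
Definition setsum (A B : set X) : set X := [set a + b | a in A & b in B].

Definition perfect_base (C : set (set X)) : Prop :=
  category_base C /\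
  (forall A, region C A -> perfect_set A) /\
  (forall A x, region C A -> A x ->
     exists An : nat -> set X,
       (forall n, region C (An n)) /\ (forall n, An n.+1 `<=` An n) /\
       (forall n, An n x) /\ (forall n, diam_le d (An n) (n.+1%:R)^-1)).

Definition translation_invariant (C : set (set X)) : Prop :=
  forall E r, C E -> C (translate E r).

Definition linearly_invariant (C : set (set X)) : Prop :=
  translation_invariant C /\
  forall E (l : R), C E -> l != 0 -> C (dilate l E).

Definition perfect_translation_base (C : set (set X)) : Prop :=
  perfect_base C /\ translation_invariant C /\
  forall A (D : set X), region C A -> countable D -> dense D ->
    abundant_everywhere C (\bigcup_(r in D) translate A r).

Definition bernstein (B : set X) : Prop :=
  forall P : set X, P !=set0 -> perfect_set P ->
    (B `&` P !=set0) /\ (~` B `&` P !=set0).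
End Vector.

(* Main.v *)
Require Import Defs.
From HB Require Import structures.
From mathcomp Require Import all_boot all_order all_algebra.
From mathcomp Require Import all_classical all_reals wochoice.
From mathcomp Require Import topology tvs lebesgue_measure.
Set Implicit Arguments. Unset Strict Implicit. Unset Printing Implicit Defensive.
Import Order.TTheory GRing.Theory Num.Theory.
Local Open Scope classical_set_scope.
Local Open Scope ring_scope.

(* Non-equivalent bases C and D, with C ccc, are orthogonal: X is the union of a
   C-meager and a D-meager set.  Indeed, either some D-region is C-meager, or D is
   ccc as well and a set that is meager for one base only can be replaced by a
   G_delta, which is then residual in a region of the other base; in both cases
   the translates of that region by a countable dense set have a singular
   complement, and translating finishes the decomposition.  Hence every set that is
   rare for C is meager for D.

   Under CH there are a cofinal family M_i of meager sets and an enumeration P_i of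
   the perfect sets, indexed by a well-order with countable initial segments.  At
   stage i choose t_i, t'_i outside all M_j with j <= i such that t_i + t'_i lies in
   P_i, together with z_i in P_i, never letting a sum t_j + t'_k be equal to some
   z_l.  Writing t'_i = p - t_i with p in P_i, this asks t_i to avoid the meager
   sets N and p - N, the second one being meager by linear invariance. *)

(** * Countable sets *)

Lemma countableU (T : Type) (A B : set T) :
  countable A -> countable B -> countable (A `|` B).
Proof.
by move=> cA cB; rewrite -bigcup2E; apply: bigcup_countable => // -[|[|i]].
Qed.

Lemma countable_range (T : Type) (D : set T) :
  countable D -> D !=set0 -> exists f : nat -> T, D = range f.
Proof.
move=> cD [x Dx].
case/pfcard_geP: cD => [D0|[f]]; first by rewrite D0 in Dx.
exists f; apply/seteqP; split => y.
  by move=> /(@surj _ _ _ _ f) [n _ <-]; exists n.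
by move=> [n _ <-]; apply: funS.
Qed.

(** * The ideals of singular and meager sets of a family *)

Section Ideals.
Variables (X : Type) (C : set (set X)).
Implicit Types (A B S : set X).

Lemma singular_sub S S' : S `<=` S' -> singular C S' -> singular C S.
Proof.
move=> SS' sS A /sS[B [rB BA BS]]; exists B; split => //.
by apply: subsetI_eq0 BS.
Qed.

Lemma singular0 : singular C set0.
Proof. by move=> A rA; exists A; split => //; rewrite setI0. Qed.

Lemma singular_meager S : singular C S -> meager C S.
Proof.
move=> sS; exists (fun=> S); split => //.
by apply/seteqP; split => [x Sx|x [n _ ?]//]; exists 0%N.
Qed.

Lemma meager_sub S S' : S `<=` S' -> meager C S' -> meager C S.
Proof.
move=> SS' [F [sF S'E]]; exists (fun n => S `&` F n); split.
  by move=> n; apply: singular_sub (sF n) => x [].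
apply/seteqP; split => [x Sx|x [n _ []]//].
by have := SS' x Sx; rewrite S'E => -[n _ Fx]; exists n.
Qed.

Lemma meager0 : meager C set0.
Proof. exact/singular_meager/singular0. Qed.

Lemma meager_bigcup_nat (F : nat -> set X) :
  (forall n, meager C (F n)) -> meager C (\bigcup_n F n).
Proof.
move=> /choice[G GF].
pose H k := if unpickle k is Some nm then G nm.1 nm.2 else set0.
exists H; split.
  rewrite /H => k; case: (unpickle k) => [[n m]|]; last exact: singular0.
  exact: (GF n).1.
apply/seteqP; split => x [n _].
  rewrite (GF n).2 => -[m _ Gx]; exists (pickle (n, m)) => //.
  by rewrite /H pickleK.
rewrite /H; case: (unpickle n) => [[i j]|//] /= Gx.
by exists i => //; rewrite (GF i).2; exists j.
Qed.

Lemma meager_bigcup (I : Type) (D : set I) (F : I -> set X) :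
  countable D -> (forall i, D i -> meager C (F i)) ->
  meager C (\bigcup_(i in D) F i).
Proof.
move=> cD mF; have [D0|/set0P] := eqVneq D set0.
  by rewrite D0 bigcup_set0; exact: meager0.
move=> /(countable_range cD)[f Df]; rewrite Df bigcup_image.
by apply: meager_bigcup_nat => n; apply: mF; rewrite Df; exists n.
Qed.

Lemma meagerU S S' : meager C S -> meager C S' -> meager C (S `|` S').
Proof.
move=> mS mS'; rewrite -bigcup2inE.
apply: meager_bigcup => // -[|[|n]]//.
Qed.

Lemma countable_meager S :
  (forall x, singular C [set x]) -> countable S -> meager C S.
Proof.
move=> s1 cS; have -> : S = \bigcup_(x in S) [set x].
  by apply/seteqP; split => [x Sx|x [_ ? ->]//]; exists x.
by apply: meager_bigcup => // x _; exact/singular_meager/s1.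
Qed.

(** Zorn's lemma provides a maximal disjoint subfamily. A member of [Q] that meets none of its
    elements could be added to it, being nonempty and hence new. *)
Lemma maximal_disjoint (Q : set (set X)) : Q `<=` region C ->
  exists D, [/\ D `<=` Q, pairwise_disjoint D &
    forall B, Q B -> exists2 E, D E & B `&` E !=set0].
Proof.
move=> Qr; have [D [DQ tD mD]] := ex_maximal_disjoint_subcollection id Q.
exists D; split => //.
  move=> D1 D2 DD1 DD2 D12; apply: contrapT => /eqP/set0P ne.
  exact/D12/(tD D1 D2 DD1 DD2).
move=> B QB; apply: contrapT => noE.
have disj E : D E -> B `&` E = set0.
  by move=> DE; apply: contrapT => /eqP/set0P ne; apply: noE; exists E.
apply: (mD (D `|` [set B])).
- split => [|DB]; first exact: subsetUl.
  have /disj : D B by apply: DB; right.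
  by rewrite setIid => B0; have [_ /set0P/eqP] := Qr _ QB.
- by move=> E [/DQ//|->].
- move=> E F [DE|->] [DF|->]//; first exact: tD.
  + by rewrite setIC disj// => -[].
  + by rewrite disj// => -[].
Qed.

(** A bijection that preserves [C] in both directions carries regions to regions, hence singular
    sets to singular sets. It serves for translations and for the reflections x |-> p - x. *)
Lemma meager_image (f g : X -> X) : cancel f g -> cancel g f ->
  (forall E, C E -> C (f @` E)) -> (forall E, C E -> C (g @` E)) ->
  forall S, meager C S -> meager C (f @` S).
Proof.
move=> fg gf Cf Cg S [F [sF ->]]; rewrite image_bigcup.
exists (fun n => f @` F n); split => // n A [CA [a Aa]].
have [|B [[CB [b Bb]] BA BF]] := sF n (g @` A).
  by split; [exact: Cg|exists (g a), a].
exists (f @` B); split.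
- by split; [exact: Cf|exists (f b), b].
- by move=> _ [x /BA [y Ay <-] <-]; rewrite gf.
- apply/seteqP; split => // _ [[x Bx <-] [y Fy]] /(can_inj fg) yx.
  suff : (B `&` F n) x by rewrite BF.
  by split => //; rewrite -yx.
Qed.

End Ideals.

(** * Category bases with uncountably many members, and the countable chain condition *)

Section UncountableBase.
Variables (X : Type) (C : set (set X)).
Hypotheses (Cbase : category_base C) (Cunc : ~ countable C).
Implicit Types (A B S : set X).

(** As [C] is uncountable, every countable family satisfies the cardinality bound of the category
    base axiom. The empty family, which that axiom excludes, is treated apart. *)
Lemma region_dichotomy A (D : set (set X)) : region C A -> D `<=` region C ->
  pairwise_disjoint D -> countable D ->
  (exists2 E, D E & contains_region C (A `&` E)) \/
  (exists B, [/\ region C B, B `<=` A & forall E, D E -> B `&` E = set0]).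
Proof.
move=> rA Dr dD cD; have [D0|/set0P D0] := eqVneq D set0.
  by right; exists A; split => // E; rewrite D0.
have DC : card_lt D C.
  split; first by apply: subset_card_le => E /Dr[].
  by move=> CD; apply: Cunc; exact: sub_countable cD.
have [h1 h2] := Cbase.2 A D rA D0 Dr dD DC.
by have [/h1|/h2] := pselect (contains_region C (A `&` \bigcup_(E in D) E));
  [left|right].
Qed.

Lemma region_dichotomy1 A B : region C A -> region C B ->
  contains_region C (A `&` B) \/
  (exists B', [/\ region C B', B' `<=` A & B' `&` B = set0]).
Proof.
move=> rA rB.
have Br : [set B] `<=` region C by move=> _ ->.
have Bd : pairwise_disjoint [set B] by move=> _ _ -> ->.
have [[_ -> ?]|[B' [? ? h]]] := region_dichotomy rA Br Bd (countable1 B).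
  by left.
by right; exists B'; split => //; exact: h.
Qed.

(** Any region has a subregion that misses A or lies in A. In the latter case it shrinks further to
    one that misses B, since a subregion inside B would lie in the intersection of A and B. *)
Lemma singular_regionI A B : region C A -> region C B ->
  ~ contains_region C (A `&` B) -> singular C (A `&` B).
Proof.
move=> rA rB nAB R rR.
have [[R' [rR' R'RA]]|[R' [rR' R'R R'A]]] := region_dichotomy1 rR rA; last first.
  by exists R'; split => //; apply: subsetI_eq0 R'A => // x [].
have [[S [rS SR'B]]|[S [rS SR' SB]]] := region_dichotomy1 rR' rB.
  case: nAB; exists S; split => // x /SR'B[/R'RA[]] //.
by exists S; split => [//|x /SR'/R'RA[]//|]; apply: subsetI_eq0 SB => // x [].
Qed.

(** A maximal disjoint subfamily of [Q] is countable by ccc. No region misses all its members, as it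
    would contain an element of [Q] contradicting maximality; so every region has a subregion inside
    one member. *)
Lemma ccc_cosingular (Q : set (set X)) : ccc C -> Q `<=` region C ->
  (forall A, region C A -> exists2 B, Q B & B `<=` A) ->
  exists D, [/\ D `<=` Q, countable D & singular C (~` \bigcup_(E in D) E)].
Proof.
move=> Cccc Qr Qsub; have [D [DQ dD mD]] := maximal_disjoint Qr.
have Dr : D `<=` region C by move=> E /DQ/Qr.
have cD : countable D by exact: Cccc.
exists D; split => // A rA.
have [[E DE [B [rB BAE]]]|[B [rB BA BD]]] := region_dichotomy rA Dr dD cD.
  exists B; split => [//|x /BAE[]//|].
  by apply/seteqP; split => // x [/BAE[_ Ex]]; apply; exists E.
have [B' QB' B'B] := Qsub B rB; have [E DE [x [B'x Ex]]] := mD _ QB'.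
suff : (B `&` E) x by rewrite BD.
by split => //; exact: B'B.
Qed.

(** The regions in which S is meager are dense among all regions, so countably many of them cover
    everything up to a singular set. *)
Lemma locally_meager S : ccc C ->
  (forall A, region C A ->
     exists B, [/\ region C B, B `<=` A & meager C (B `&` S)]) ->
  meager C S.
Proof.
move=> Cccc Sloc.
have [||D [DQ cD sD]] :=
    @ccc_cosingular [set B | region C B /\ meager C (B `&` S)] Cccc.
- by move=> B [].
- by move=> A /Sloc[B [rB BA mB]]; exists B.
apply: (@meager_sub _ _ _
    ((\bigcup_(E in D) (E `&` S)) `|` ~` \bigcup_(E in D) E)).
  move=> x Sx; have [[E DE Ex]|nx] := pselect ((\bigcup_(E in D) E) x).
    by left; exists E.
  by right.
apply: meagerU; last exact: singular_meager.
by apply: meager_bigcup => // E /DQ[].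
Qed.

Lemma abundant_region S : ccc C -> abundant C S -> exists2 A, region C A &
  forall B, region C B -> B `<=` A -> abundant C (B `&` S).
Proof.
move=> Cccc aS; apply: contrapT => noA; apply: aS; apply: locally_meager => //.
move=> A rA; apply: contrapT => noB; apply: noA; exists A => // B rB BA mB.
by apply: noB; exists B.
Qed.

(** This gives singular sets a hull with a countable description: a G_delta when regions are closed,
    and an object that can be coded by a set of natural numbers. *)
Lemma singular_hull S : ccc C -> singular C S ->
  exists D, [/\ D `<=` region C, countable D, S `<=` ~` \bigcup_(E in D) E &
    singular C (~` \bigcup_(E in D) E)].
Proof.
move=> Cccc sS.
have [||D [DQ cD sD]] :=
    @ccc_cosingular [set B | region C B /\ B `&` S = set0] Cccc.
- by move=> B [].
- by move=> A /sS[B [rB BA mB]]; exists B.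
exists D; split => // [B /DQ[]//|x Sx [E /DQ[_ ES] Ex]].
suff : (E `&` S) x by rewrite ES.
by [].
Qed.

End UncountableBase.

(** * The real line, metric neighbourhoods, and neighbourhoods of 0 in a vector space *)

Lemma real_uncountable (R : realType) : ~ countable [set: R].
Proof.
move=> cR; have : countable ([set` `[0, 1]] : set R).
  by apply: sub_countable cR; exact: card_leT.
move/countable_lebesgue_measure0; rewrite lebesgue_measure_itv/= lte_fin ltr01.
by rewrite sube0 => /eqP; rewrite eqe oner_eq0.
Qed.

Section MetricTopology.
Variables (R : realType) (X : topologicalType) (d : X -> X -> R).
Hypotheses (hd : is_metric d) (hcompat : metric_compatible d).

Lemma is_metric_refl x : d x x = 0.
Proof. by have [h _ _] := hd; apply/h. Qed.

Lemma is_metric_sym x y : d x y = d y x.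
Proof. by have [_ h _] := hd. Qed.

Lemma is_metric_triangle y x z : d x z <= d x y + d y z.
Proof. by have [_ _ h] := hd. Qed.

Lemma is_metric_ge0 x y : 0 <= d x y.
Proof.
have := is_metric_triangle y x x.
by rewrite is_metric_refl (is_metric_sym y) -mulr2n pmulrn_lge0.
Qed.

Lemma is_metric_gt0 x y : x <> y -> 0 < d x y.
Proof.
move=> xy; rewrite lt_neqAle is_metric_ge0 andbT eq_sym.
by apply/eqP => dxy; apply: xy; have [h _ _] := hd; apply/h.
Qed.

Lemma metric_ball_open x e : open [set y | d x y < e].
Proof.
apply/hcompat => y /= dxy; exists (e - d x y); first by rewrite subr_gt0.
move=> z /= dyz; apply: le_lt_trans (is_metric_triangle y x z) _.
by rewrite addrC -ltrBrDr.
Qed.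

Lemma metric_nbhsP (x : X) (U : set X) :
  nbhs x U <-> exists2 e, 0 < e & [set y | d x y < e] `<=` U.
Proof.
split => [|[e e0 eU]].
  rewrite nbhsE => -[O [oO Ox] OU]; have /hcompat/(_ x Ox)[e e0 eO] := oO.
  by exists e => // y /eO/OU.
rewrite nbhsE; exists [set y | d x y < e] => //.
by split; [exact: metric_ball_open|rewrite /= is_metric_refl].
Qed.

Lemma metric_nbhs_neq (x y : X) : x <> y -> nbhs x [set z : X | z <> y].
Proof.
move=> xy; apply/metric_nbhsP; exists (d x y); first exact: is_metric_gt0.
by move=> z /= + zy; rewrite zy ltxx.
Qed.

End MetricTopology.

Section TopologicalModule.
Variables (R : realType) (X : topologicalLmodType R).

Lemma nbhs0_translate (x : X) (U : set X) :
  nbhs x U -> nbhs (0 : X) [set v | U (x + v)].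
Proof.
move=> xU; have := @add_continuous X (x, 0) U; rewrite /= addr0 => /(_ xU).
case=> -[A B] /= [xA B0] AB; apply: filterS B0 => v Bv.
by apply: (AB (x, v)); split => //=; exact: nbhs_singleton.
Qed.

Lemma nbhs0_sub (U : set X) : nbhs (0 : X) U ->
  exists2 V, nbhs (0 : X) V & forall x y, V x -> V y -> U (x - y).
Proof.
move=> U0; have := @sub_continuous X (0, 0) U; rewrite /= subrr => /(_ U0).
case=> -[A B] /= [A0 B0] AB; exists (A `&` B); first exact: filterI.
by move=> x y [Ax _] [_ By]; exact: (AB (x, y)).
Qed.

(** Continuity of scaling at (0, 0) only handles scalars of modulus below some e. Factoring a as (a
    e/2) (e/2)^-1 reduces the unit ball of scalars to that case. *)
Lemma nbhs0_balanced (U : set X) : nbhs (0 : X) U ->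
  nbhs (0 : X) [set x | forall a : R, `|a| <= 1 -> U (a *: x)].
Proof.
move=> U0; have := @scale_continuous R X (0, 0) U; rewrite /= scaler0 => /(_ U0).
case=> -[A B] /= [/nbhs_ballP[e /= e0 eA] B0] AB.
have := @scale_continuous R X ((e / 2)^-1, 0) B; rewrite /= scaler0 => /(_ B0).
case=> -[A' B'] /= [A'e B'0] AB'; apply: filterS B'0 => x B'x a a1 /=.
have -> : a *: x = (a * (e / 2)) *: ((e / 2)^-1 *: x).
  by rewrite scalerA mulfK// mulf_neq0 ?invr_eq0 ?gt_eqF.
apply: (AB (a * (e / 2), (e / 2)^-1 *: x)); split => /=.
  apply: eA; rewrite /ball/= sub0r normrN normrM.
  rewrite (@le_lt_trans _ _ `|e / 2|)//; first by rewrite ler_piMl.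
  by rewrite gtr0_norm ?divr_gt0// ltr_pdivrMr// ltr_pMr// ltr1n.
apply: (AB' ((e / 2)^-1, x)); split => //=.
exact: (nbhs_singleton A'e).
Qed.

Lemma translateE (A : set X) r x : translate A r x <-> A (x - r).
Proof.
split => [[a Aa <-]|Axr]; first by rewrite addrK.
by exists (x - r) => //; rewrite subrK.
Qed.

End TopologicalModule.

(** * Regions and closed sets in a perfect translation base *)

Section PerfectTranslationBase.
Variables (R : realType) (X : topologicalLmodType R) (d : X -> X -> R).
Hypotheses (hd : is_metric d) (hcompat : metric_compatible d).
Hypothesis hsep : separable_space X.
Variable C : set (set X).
Hypothesis hC : perfect_translation_base d C.
Implicit Types (A B S F : set X).

Let Cbase : category_base C. Proof. by have [[]] := hC. Qed.

Lemma region_at (x : X) U : nbhs x U -> exists B, [/\ region C B, B x & B `<=` U].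
Proof.
move=> /(metric_nbhsP hd hcompat)[e e0 eU].
have [[hb [_ hshrink]] _] := hC.
have [A CA Ax] : (\bigcup_(A in C) A) x by rewrite hb.1.
have [|An [rAn [_ [Anx dAn]]]] := hshrink A x _ Ax; first by split => //; exists x.
have [n] := ltr_add_invr e0; rewrite add0r => ne.
exists (An n); split => // y Any; apply: eU => /=.
exact: le_lt_trans (dAn n x y (Anx n) Any) ne.
Qed.

Lemma region_translate A r : region C A -> region C (translate A r).
Proof.
move=> [CA [x Ax]]; split; last by exists (x + r), x.
by have [_ [h _]] := hC; exact: h.
Qed.

Lemma region_closed A : region C A -> closed A.
Proof. by move=> rA; have [[_ [h _]] _] := hC; have [] := h A rA. Qed.

Lemma nbhs_infinite (x : X) U : nbhs x U -> exists2 y, y != x & U y.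
Proof.
move=> xU; have [A [rA Ax _]] := region_at (@filterT _ (nbhs x) _).
have [[_ [h _]] _] := hC; have [_ limA] := h A rA.
by have : limit_point A x by [rewrite limA]; move/(_ U xU) => [y [yx _ Uy]]; exists y.
Qed.

(* For a small region A containing 0 and v != 0, the translates A + l v, with l a
   real number, are distinct: otherwise A contains n l v for some l > 0 and all n. *)
Lemma base_uncountable : ~ countable C.
Proof.
have [v v0 _] := nbhs_infinite (@filterT _ (nbhs (0 : X)) _).
have /nbhs0_balanced/nbhs0_sub[V V0 Vsub] :=
  metric_nbhs_neq hd hcompat (not_eq_sym (elimN eqP v0)).
have [A [rA A0 AV]] := region_at V0.
have noperiod t : 0 < t -> translate A (t *: v) = A -> False.
  move=> t0 At.
  have Ant n : A (n%:R * t *: v).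
    elim: n => [|n IHn]; first by rewrite mul0r scale0r.
    rewrite -natr1 mulrDl mul1r scalerDl -At; exact/imageP.
  have [n] := ltr_add_invr t0; rewrite add0r => nt.
  (* The inverse of (n+1)t is at most 1 and scales (n+1)tv back to v, which the balanced
     neighbourhood of 0 was chosen to avoid. *)
  apply: (Vsub _ _ (AV _ (Ant n.+1)) (AV _ A0) (n.+1%:R * t)^-1).
    rewrite normfV gtr0_norm ?mulr_gt0// invf_le1 ?mulr_gt0//.
    by rewrite mulrC -ler_pdivrMr// div1r ltW.
  by rewrite subr0 scalerA mulVf ?scale1r// gt_eqF// mulr_gt0.
have inj : injective (fun t : R => translate A (t *: v)).
  have wlog s t : s < t -> translate A (s *: v) <> translate A (t *: v).
    move=> st Est; apply: (@noperiod (t - s)); first by rewrite subr_gt0.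
    apply/seteqP; split => x.
      move/translateE => Ax.
      have : translate A (t *: v) (x + s *: v).
        by apply/translateE; move: Ax; rewrite scalerBl opprB addrA.
      by rewrite -Est => /translateE; rewrite addrK.
    move=> Ax; apply/translateE.
    have : translate A (s *: v) (x + s *: v) by apply/translateE; rewrite addrK.
    by rewrite Est => /translateE; rewrite scalerBl opprB addrA (addrAC x).
  move=> s t Est; apply: contrapT => /eqP; rewrite neq_lt => /orP[] /wlog; apply.
    exact: Est.
  exact: (esym Est).
move=> cC; apply: (@real_uncountable R).
have : countable ((fun t : R => translate A (t *: v)) @` setT).
  apply: sub_countable cC; apply: subset_card_le => _ [t _ <-].
  by have [] := region_translate (t *: v) rA.
apply: sub_countable; have := inj_card_eq (in2W inj : {in setT &, injective _}).
by rewrite card_eq_le => /andP[].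
Qed.

Let Cunc := base_uncountable.

Lemma region_abundant A : region C A -> abundant C A.
Proof.
move=> rA mA; have [D [cD dD]] := hsep; have [_ [_ h]] := hC.
by apply: (h A D rA cD dD A rA); apply: meager_sub mA => x [].
Qed.

Lemma abundant_regionI A B : region C A -> region C B ->
  abundant C (A `&` B) -> contains_region C (A `&` B).
Proof.
move=> rA rB aAB; apply: contrapT => nAB.
exact/aAB/singular_meager/(singular_regionI Cbase Cunc).
Qed.

(** The union of the translates is abundant in A, so one of the countably many sets A [&] (B + r) is
    abundant; an intersection of two regions that contains no region would be singular. *)
Lemma translates_meet A B (D : set X) :
  region C A -> region C B -> countable D -> dense D ->
  exists2 r, D r & contains_region C (A `&` translate B r).
Proof.
move=> rA rB cD dD; apply: contrapT => noR; have [_ [_ h]] := hC.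
apply: (h B D rB cD dD A rA); rewrite setI_bigcupr.
apply: meager_bigcup => // r Dr; apply: contrapT => /abundant_regionI ABr.
by apply: noR; exists r => //; apply: ABr => //; exact: region_translate.
Qed.

(* The definition of a perfect base does not put the shrinking regions at a point
   of A inside A; abundance of the translates of one small region repairs this. *)
Lemma small_subregion A V : region C A -> nbhs (0 : X) V ->
  exists B, [/\ region C B, B `<=` A & forall x y, B x -> B y -> V (x - y)].
Proof.
move=> rA /nbhs0_sub[W W0 WV]; have [S [rS _ SW]] := region_at W0.
have [D [cD dD]] := hsep.
have [r _ [B [rB BAS]]] := translates_meet rA rS cD dD.
exists B; split => // [x /BAS[]//|x y /BAS[_ /translateE Sx] /BAS[_ /translateE Sy]].
by have := WV _ _ (SW _ Sx) (SW _ Sy); rewrite opprB addrA subrK.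
Qed.

(* If every subregion of A contained x, then A `&` (A + r) would be singular
   for every r != 0, so A would miss most of the translates of A by the nonzero
   elements of a countable dense set. *)
Lemma singular_set1 x : singular C [set x].
Proof.
move=> A rA; apply: contrapT => noB.
have core B : region C B -> B `<=` A -> B x.
  move=> rB BA; apply: contrapT => nBx; apply: noB; exists B; split => //.
  by apply/seteqP; split => // y [By yx]; apply: nBx; rewrite -yx.
have [D [cD dD]] := hsep.
have [|O O0 oO|r [Dr r0] [B [rB BA]]] :=
    @translates_meet A A (D `&` [set r | r != 0]) rA rA.
- by apply: sub_countable cD; apply: subset_card_le => r [].
(* Removing 0 keeps D dense because the space has no isolated points. *)
- have oO' : open (O `&` [set r : X | r != 0]).
    rewrite openE => y [Oy y0]; apply: filterI; first exact: open_nbhs_nbhs.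
    apply: filterS (metric_nbhs_neq hd hcompat (elimN eqP y0)) => z z0.
    exact/eqP.
  have [y [Oy y0]] : (O `&` [set r : X | r != 0]) !=set0.
    case: O0 => y Oy; have [z zy Oz] := nbhs_infinite (open_nbhs_nbhs (conj oO Oy)).
    have [y0|y0] := eqVneq y 0; last by exists y.
    by exists z; split => //; rewrite -y0.
  by have [|z [[Oz z0] Dz]] := dD _ _ oO'; [exists y|exists z].
(* Both B' and B' - r are regions inside A, so both contain x. Then x and x + r lie in B', which was
   taken too small for the difference r. *)
have [B' [rB' B'B B'r]] :=
  small_subregion rB (metric_nbhs_neq hd hcompat (not_eq_sym (elimN eqP r0))).
have B'x : B' x by apply: core => // y /B'B/BA[].
have : translate B' (- r) x.
  apply: core; first exact: region_translate.
  by move=> _ [y /B'B/BA[_ /translateE Ay] <-].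
move/translateE; rewrite opprK => B'xr.
by apply: (B'r _ _ B'xr B'x); rewrite addrC addKr.
Qed.

Lemma base_countable_meager S : countable S -> meager C S.
Proof. exact: (countable_meager singular_set1). Qed.

(** The complement of F is the union of the sets [Fn n] of points x with x + [V n] disjoint from F.
    Some [A & Fn n] is not singular, so it meets every subregion of some region S. A subregion of
    both S and A with differences in [V n] then contains a point of [Fn n] and must miss F. *)
Lemma closed_subregion F A : closed F -> region C A -> abundant C (A `\` F) ->
  exists B, [/\ region C B, B `<=` A & B `&` F = set0].
Proof.
move=> cF rA aAF; pose V n : set X := [set v | d 0 v < n.+1%:R^-1].
have V0 n : nbhs (0 : X) (V n).
  by apply/(metric_nbhsP hd hcompat); exists n.+1%:R^-1; rewrite // invr_gt0.
pose Fn n := [set x | forall v, V n v -> ~ F (x + v)].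
have FnE : ~` F = \bigcup_n Fn n.
  apply/seteqP; split => [x nFx|x [n _ Fnx] Fx]; last first.
    by apply: (Fnx 0); [exact: nbhs_singleton|rewrite addr0].
  have : nbhs x (~` F) by apply: open_nbhs_nbhs; split => //; exact: closed_openC.
  move/nbhs0_translate/(metric_nbhsP hd hcompat) => [e e0 eF].
  have [n] := ltr_add_invr e0; rewrite add0r => ne.
  by exists n => // v Vv; apply: eF; exact: lt_trans ne.
have [n aAn] : exists n, abundant C (A `&` Fn n).
  apply: contrapT => noN; apply: aAF; rewrite setDE FnE setI_bigcupr.
  apply: meager_bigcup => // n _; apply: contrapT => aAn.
  by apply: noN; exists n.
have [S rS Smeets] : exists2 S, region C S &
    forall B, region C B -> B `<=` S -> B `&` (A `&` Fn n) !=set0.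
  apply: contrapT => noS; apply: aAn; apply: singular_meager => S rS.
  apply: contrapT => noB; apply: noS; exists S => // B rB BS.
  by apply: contrapT => /set0P/negP/negPn/eqP B0; apply: noB; exists B.
have [[B [rB BSA]]|[B [rB BS BA]]] := region_dichotomy1 Cbase Cunc rS rA; last first.
  have [x [Bx [Ax _]]] := Smeets B rB BS.
  suff : (B `&` A) x by rewrite BA.
  by [].
have [B' [rB' B'B B'V]] := small_subregion rB (V0 n).
exists B'; split => // [x /B'B/BSA[]//|].
have [x [B'x [_ Fnx]]] := Smeets B' rB' (subset_trans B'B (fun y By => (BSA y By).1)).
apply/seteqP; split => // y [B'y Fy].
by apply: (Fnx _ (B'V _ _ B'y B'x)); rewrite addrC subrK.
Qed.

Lemma closed_abundant F : closed F -> abundant C F ->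
  exists2 A, region C A & meager C (A `\` F).
Proof.
move=> cF aF; apply: contrapT => noA; apply/aF/singular_meager => A rA.
by apply: closed_subregion => // mA; apply: noA; exists A.
Qed.

Lemma meager_diff_contains A B : region C A -> region C B ->
  meager C (A `\` B) -> contains_region C (A `&` B).
Proof.
move=> rA rB mAB; have [//|[B' [rB' B'A B'B]]] := region_dichotomy1 Cbase Cunc rA rB.
case: (region_abundant rB'); apply: meager_sub mAB => x B'x; split; first exact: B'A.
move=> Bx; suff : (B' `&` B) x by rewrite B'B.
by [].
Qed.

(** Take A in all of whose subregions the G_delta is abundant. If [A & F] were abundant for some F
    in D, it would contain a region up to a meager set, hence A would have a subregion in which the
    G_delta is meager. *)
Lemma Gdelta_abundant (D : set (set X)) : ccc C -> countable D ->
  (forall F, D F -> closed F) -> abundant C (~` \bigcup_(F in D) F) ->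
  exists2 A, region C A & meager C (A `&` \bigcup_(F in D) F).
Proof.
move=> Cccc cD clD /(abundant_region Cbase Cunc Cccc)[A rA aA].
exists A => //; rewrite setI_bigcupr; apply: meager_bigcup => // F DF.
apply: contrapT => /closed_abundant[|B rB mB].
  by apply: closedI; [exact: region_closed|exact: clD].
have [|B' [rB' B'BA]] := @meager_diff_contains B A rB rA.
  by apply: meager_sub mB => x [Bx nAx]; split => // -[].
apply: (aA B' rB'); first by move=> x /B'BA[].
apply: meager_sub mB => x [B'x nFx]; have [Bx Ax] := B'BA x B'x.
by split => // -[_ Fx]; apply: nFx; exists F.
Qed.

Lemma translates_cosingular B (D : set X) : region C B -> countable D -> dense D ->
  singular C (~` \bigcup_(r in D) translate B r).
Proof.
move=> rB cD dD A rA; have [r Dr [B' [rB' B'AB]]] := translates_meet rA rB cD dD.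
exists B'; split => // [x /B'AB[]//|].
by apply/seteqP; split => // x [/B'AB[_ ?]]; apply; exists r.
Qed.

Lemma meager_translate S r : meager C S -> meager C (translate S r).
Proof.
apply: (@meager_image _ _ (fun x => x + r) (fun x => x - r)).
- by move=> x; rewrite addrK.
- by move=> x; rewrite subrK.
- by have [_ [h _]] := hC; move=> E CE; exact: h.
- by have [_ [h _]] := hC; move=> E CE; exact: h.
Qed.

End PerfectTranslationBase.

(** * Comparison of two perfect translation bases *)

Section TwoBases.
Variables (R : realType) (X : topologicalLmodType R) (d : X -> X -> R).
Hypotheses (hd : is_metric d) (hcompat : metric_compatible d).
Hypothesis hsep : separable_space X.
Implicit Types (A B S : set X) (C D : set (set X)).

(** N consists of the translates of [B & S] by a countable dense set. Its complement is covered by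
    the D-singular complement of the translates of B and by the translates of the D-meager set B
    minus S. *)
Lemma orthogonal_of_region C D B S :
  perfect_translation_base d C -> perfect_translation_base d D -> region D B ->
  meager D (B `\` S) -> meager C (B `&` S) ->
  exists N, meager C N /\ meager D (~` N).
Proof.
move=> hC hD rB mD mC; have [Q [cQ dQ]] := hsep.
exists (\bigcup_(r in Q) translate (B `&` S) r); split.
  by apply: meager_bigcup => // r _; exact: (meager_translate hC).
apply: (@meager_sub _ _ _ (~` (\bigcup_(r in Q) translate B r) `|`
    \bigcup_(r in Q) translate (B `\` S) r)).
  move=> x nx; have [[r Qr [y By yx]]|?] :=
    pselect ((\bigcup_(r in Q) translate B r) x); last by left.
  right; exists r => //; exists y => //; split => // Sy; apply: nx.
  by exists r => //; exists y.
apply: meagerU.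
  exact/singular_meager/(translates_cosingular hd hcompat hD).
by apply: meager_bigcup => // r _; exact: (meager_translate hD).
Qed.

(* Disjoint D-regions contain, up to C-meager sets, C-regions whose pairwise
   intersections are C-meager. *)
Lemma ccc_transfer C D :
  perfect_translation_base d C -> perfect_translation_base d D -> ccc C ->
  (forall B, region D B -> abundant C B) -> ccc D.
Proof.
move=> hC hD Cccc aD G Gr dG.
have Cbase : category_base C by have [[]] := hC.
have Cunc := base_uncountable hd hcompat hC.
have /choice[core coreP] : forall B, exists A,
    G B -> region C A /\ meager C (A `\` B).
  move=> B; have [GB|] := pselect (G B); last by exists set0.
  have [|A rA mA] := closed_abundant hd hcompat hsep hC _ (aD B (Gr B GB)).
    exact: (region_closed hD (Gr B GB)).
  by exists A.
have core_disj B B' : G B -> G B' -> B <> B' ->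
    ~ contains_region C (core B `&` core B').
  move=> GB GB' BB' [A [rA AB]]; apply: (region_abundant hsep hC rA).
  apply: (@meager_sub _ _ _ ((core B `\` B) `|` (core B' `\` B'))).
    move=> x /AB[Bx B'x]; have [xB|] := pselect (B x); last by left.
    right; split => // xB'; suff : (B `&` B') x by rewrite dG.
    by [].
  by apply: meagerU; [have [] := coreP B GB|have [] := coreP B' GB'].
have [|E [EQ dE mE]] := @maximal_disjoint X C
    [set A | region C A /\ exists2 B, G B & A `<=` core B].
  by move=> A [].
have Er : E `<=` region C by move=> A /EQ[].
have cE : countable E by exact: Cccc.
have /choice[w wP] : forall A, exists B, E A -> G B /\ A `<=` core B.
  move=> A; have [/EQ[_ [B GB AB]]|] := pselect (E A); first by exists B.
  by exists set0.
have cwE : countable (w @` E) by apply: sub_countable cE; exact: card_image_le.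
(* Every B in G is [w A] for some A in E: otherwise, by [core_disj], [core B] shares no subregion
   with any member of E, so it contains a region missing all of E, against maximality. *)
apply: sub_countable cwE; apply: subset_card_le => B GB.
apply: contrapT => nB; have [rB mB] := coreP B GB.
have [[A EA [A' [rA' A'sub]]]|[A [rA AB Adisj]]] :=
    region_dichotomy Cbase Cunc rB Er dE cE.
  have [GwA AwA] := wP A EA; apply: (@core_disj B (w A)) => //.
    by move=> BwA; apply: nB; exists A.
  by exists A'; split => // x /A'sub[Bx /AwA].
have [|A' EA'] := mE A; last by rewrite Adisj// => -[].
by split => //; exists B.
Qed.

(** Regions of both bases are closed, so each abundant one contains a region of the other base up to
    a meager set. One passes from a D-region to a C-region, shrinks it there to decide E, and passes
    back. *)
Lemma baire_set_of_meager C D :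
  perfect_translation_base d C -> perfect_translation_base d D ->
  (forall S, meager C S <-> meager D S) ->
  forall E, baire_set C E -> baire_set D E.
Proof.
move=> hC hD CD E bE B rB.
have [||A rA mAB] := @closed_abundant _ _ _ hd hcompat hsep _ hC B.
- exact: (region_closed hD rB).
- by move=> /CD; exact: (region_abundant hsep hD rB).
have [A' [rA' A'A mE]] := bE A rA.
have aA'B : abundant D (A' `&` B).
  move=> /CD mA'B; apply: (region_abundant hsep hC rA').
  apply: (@meager_sub _ _ _ ((A' `&` B) `|` (A `\` B))); last exact: meagerU.
  move=> x A'x; have [Bx|nBx] := pselect (B x); first by left.
  by right; split => //; exact: A'A.
have [|B' rB' mB'] := closed_abundant hd hcompat hsep hD _ aA'B.
  by apply: closedI; [exact: (region_closed hC)|exact: (region_closed hD)].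
have [|B1 [rB1 B1sub]] := meager_diff_contains hd hcompat hsep hD rB' rB.
  by apply: meager_sub mB' => x [B'x nBx]; split => // -[].
exists B1; split => // [x /B1sub[]//|].
have trim S : meager C (A' `&` S) -> meager D (B1 `&` S).
  move=> /CD mS.
  apply: (@meager_sub _ _ _ ((A' `&` S) `|` (B' `\` (A' `&` B)))).
    move=> x [B1x Sx]; have [A'x|nA'x] := pselect (A' x); first by left.
    by right; split => [|[]//]; have [] := B1sub x B1x.
  exact: meagerU.
by case: mE => /trim; [left|right].
Qed.

Lemma equivalent_of_meager C D :
  perfect_translation_base d C -> perfect_translation_base d D ->
  (forall S, meager C S <-> meager D S) -> equivalent_bases C D.
Proof.
move=> hC hD CD; split => // E; split; apply: baire_set_of_meager => //.
by move=> S; apply: iff_sym; exact: CD.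
Qed.

(** Some C-singular piece of S is not D-meager. Its hull is a C-singular G_delta that is D-abundant,
    hence residual in some D-region. *)
Lemma orthogonal_of_meager C D S :
  perfect_translation_base d C -> perfect_translation_base d D ->
  ccc C -> ccc D -> meager C S -> abundant D S ->
  exists N, meager C N /\ meager D (~` N).
Proof.
move=> hC hD Cccc Dccc [F [sF ->]] aF.
have Cbase : category_base C by have [[]] := hC.
have [n aFn] : exists n, abundant D (F n).
  apply: contrapT => noN; apply: aF; apply: meager_bigcup_nat => n.
  by apply: contrapT => aFn; apply: noN; exists n.
have [E [Er cE FE sE]] :=
  singular_hull Cbase (base_uncountable hd hcompat hC) Cccc (sF n).
have [| |A rA mA] := Gdelta_abundant hd hcompat hsep hD Dccc cE.
- by move=> B /Er; exact: (region_closed hC).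
- by move=> mE; apply: aFn; apply: meager_sub mE.
apply: (@orthogonal_of_region C D A (~` \bigcup_(B in E) B)) => //.
  by rewrite setDE setCK.
by apply: meager_sub (singular_meager sE) => x [].
Qed.

Lemma nonequivalent_orthogonal C D :
  perfect_translation_base d C -> perfect_translation_base d D -> ccc C ->
  ~ equivalent_bases C D -> exists N, meager C N /\ meager D (~` N).
Proof.
move=> hC hD Cccc nCD.
have [[B rB mB]|aD] := pselect (exists2 B, region D B & meager C B).
  apply: (@orthogonal_of_region C D B setT) => //; last by rewrite setIT.
  by rewrite setDT; exact: meager0.
have Dccc : ccc D.
  apply: (@ccc_transfer C) => // B rB mB.
  by apply: aD; exists B.
have [[S mCS aDS]|CD] := pselect (exists2 S, meager C S & abundant D S).
  exact: (@orthogonal_of_meager C D S).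
have [[S mDS aCS]|DC] := pselect (exists2 S, meager D S & abundant C S).
  have [N [mDN mCN]] := @orthogonal_of_meager D C S hD hC Dccc Cccc mDS aCS.
  by exists (~` N); rewrite setCK.
case: nCD; apply: equivalent_of_meager => // S; split => mS.
  by apply: contrapT => aS; apply: CD; exists S.
by apply: contrapT => aS; apply: DC; exists S.
Qed.

End TwoBases.

(** * Perfect sets are uncountable; coding of closed and of meager sets by sets of natural
    numbers *)

Lemma perfect_uncountable (R : realType) (X : topologicalType) (d : X -> X -> R)
    (P : set X) : is_metric d -> metric_compatible d -> metric_complete d ->
  P !=set0 -> perfect_set P -> ~ countable P.
Proof.
move=> hd hcompat hcompl P0 [clP limP] /countable_range/(_ P0)[f Pf].
(* A pair is a centre in P and a radius. The fourth condition nests the closed balls, the third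
   makes the centres Cauchy, and the last keeps [f n] out of the new closed ball. *)
pose good n (cr cr' : X * R) := [/\ P cr'.1, 0 < cr'.2, cr'.2 < n.+1%:R^-1,
  d cr.1 cr'.1 + cr'.2 <= cr.2 & cr'.2 < d cr'.1 (f n)].
have /choice[step stepP] : forall ncr : nat * (X * R), exists cr' : X * R,
    P ncr.2.1 -> 0 < ncr.2.2 -> good ncr.1 ncr.2 cr'.
  move=> [n [c r]] /=; have [[Pc r0]|] := pselect (P c /\ 0 < r); last first.
    by move=> h; exists (c, r) => Pc r0; case: h.
  have [c' [Pc' cc' /eqP c'f]] : exists c', [/\ P c', d c c' < r / 2 & c' != f n].
    have [<-|cf] := eqVneq c (f n); last first.
      by exists c; split => //; rewrite (is_metric_refl hd) divr_gt0.
    have : nbhs c [set y | d c y < r / 2].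
      by apply/(metric_nbhsP hd hcompat); exists (r / 2) => //; rewrite divr_gt0.
    have : limit_point P c by rewrite limP.
    by move=> /[apply] -[y [yc Py cy]]; exists y; split.
  have c'f0 := is_metric_gt0 hd c'f.
  pose r' := Num.min (r / 2) (Num.min (n.+1%:R^-1 / 2) (d c' (f n) / 2)).
  have half (a : R) : 0 < a -> a / 2 < a.
    by move=> a0; rewrite ltr_pdivrMr// ltr_pMr// ltr1n.
  exists (c', r') => _ _; split => //=.
  - by rewrite !lt_min !divr_gt0// invr_gt0.
  - by rewrite !gt_min half ?invr_gt0// orbT.
  - rewrite [leRHS]splitr lerD ?(ltW cc')//.
    by rewrite /r' ge_min lexx.
  - by rewrite !gt_min half// !orbT.
have [c0 Pc0] := P0.
pose s := fix s n : X * R := if n is m.+1 then step (m, s m) else (c0, 1).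
have sP n : P (s n).1 /\ 0 < (s n).2.
  elim: n => [|n [Pn rn]]; first by split => //=; exact: ltr01.
  by have [] := stepP (n, s n) Pn rn.
have sgood n : good n (s n) (s n.+1) by have [Pn rn] := sP n; exact: (stepP (n, s n)).
have nest n k : d (s n).1 (s (n + k)%N).1 + (s (n + k)%N).2 <= (s n).2.
  elim: k => [|k IHk]; first by rewrite addn0 (is_metric_refl hd) add0r.
  apply: le_trans IHk; rewrite addnS; have [_ _ _ h _] := sgood (n + k)%N.
  have tri := is_metric_triangle hd (s (n + k)%N).1 (s n).1 (s (n + k).+1).1.
  by rewrite (le_trans (lerD tri (lexx _)))// -addrA lerD2l.
have dist n m : (n <= m)%N -> d (s n).1 (s m).1 <= (s n).2.
  move=> /subnKC <-; apply: le_trans (nest n (m - n)%N).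
  by rewrite lerDl ltW// (sP _).2.
have [|l lP] := hcompl (fun n => (s n).1).
  move=> e e0; have e20 : 0 < e / 2 by rewrite divr_gt0.
  have [n] := ltr_add_invr e20; rewrite add0r => ne; exists n.+1 => p q np nq.
  have [_ _ rn _ _] := sgood n.
  apply: le_lt_trans (is_metric_triangle hd (s n.+1).1 _ _) _.
  rewrite [ltRHS]splitr ltrD// (le_lt_trans _ (lt_trans rn ne))//; last exact: dist.
  by rewrite (is_metric_sym hd); exact: dist.
have dl n : d (s n).1 l <= (s n).2.
  apply/ler_addgt0Pr => e e0; have [N NP] := lP e e0.
  apply: le_trans (is_metric_triangle hd (s (maxn n N)).1 _ _) _.
  by rewrite lerD ?dist ?leq_maxl// ltW// NP// leq_maxr.
have Pl : P l.
  apply: clP => U /(metric_nbhsP hd hcompat)[e e0 eU]; have [N NP] := lP e e0.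
  exists (s N).1; split; first exact: (sP N).1.
  by apply: eU; rewrite /= (is_metric_sym hd); exact: NP.
have := Pl; rewrite Pf => -[k _ fkl]; have [_ _ _ _] := sgood k.
by rewrite fkl => /(le_lt_trans (dl k.+1)); rewrite ltxx.
Qed.

(** A set of codes stands for the complement of the union of the coded balls, with centres in a
    countable dense set and radii 1/(m+1). A closed F comes from the codes of all balls disjoint
    from it. *)
Lemma closed_coding (R : realType) (X : topologicalType) (d : X -> X -> R) :
  is_metric d -> metric_compatible d -> separable_space X ->
  exists g : set nat -> set X, forall F, closed F -> exists S, g S = F.
Proof.
move=> hd hcompat [D [cD dD]]; have [D0|/set0P D0] := eqVneq D set0.
  exists (fun=> set0) => F _; exists set0; apply: esym; apply: contrapT => /eqP/set0P[x _].
  have [|y []] := dD setT _ openT; first by exists x.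
  by rewrite D0.
have [q Dq] := countable_range cD D0.
pose U k : set X :=
  if unpickle k is Some nm then [set y | d (q nm.1) y < nm.2.+1%:R^-1] else set0.
exists (fun S => ~` \bigcup_(k in S) U k) => F clF.
exists [set k | U k `&` F = set0]; apply/seteqP; split => [x nx|x Fx [k /= UF Ux]].
  apply: contrapT => nFx.
  have : nbhs x (~` F) by apply: open_nbhs_nbhs; split => //; exact: closed_openC.
  move/(metric_nbhsP hd hcompat) => [e e0 eF].
  have e20 : 0 < e / 2 by rewrite divr_gt0.
  have [m] := ltr_add_invr e20; rewrite add0r => me.
  have [||y [/= xy]] := dD [set y | d x y < m.+1%:R^-1].
  - by exists x; rewrite /= (is_metric_refl hd) invr_gt0.
  - exact: metric_ball_open hd hcompat _ _.
  rewrite Dq => -[n _ qy]; apply: nx; exists (pickle (n, m)); last first.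
    by rewrite /U pickleK /= qy (is_metric_sym hd).
  apply/seteqP; split => // z []; rewrite /U pickleK /= qy => yz Fz.
  apply: (eF z) => //=; apply: le_lt_trans (is_metric_triangle hd y _ _) _.
  by rewrite [ltRHS]splitr ltrD ?(lt_trans _ me).
suff : (U k `&` F) x by rewrite UF.
by [].
Qed.

(** By [singular_hull] a meager set lies in a meager set built from a double sequence of members of
    [C]. Since [C] injects into the sets of naturals, such a sequence is coded by a single one. *)
Lemma meager_coding (X : Type) (C : set (set X)) :
  category_base C -> ~ countable C -> ccc C -> card_le C [set: set nat] ->
  exists M : set nat -> set X, (forall s, meager C (M s)) /\
    forall S, meager C S -> exists s, S `<=` M s.
Proof.
move=> Cbase Cunc Cccc /pcard_leTP/injPex[f finj].
pose g s := xget set0 [set E | C E /\ f E = s].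
have gf E : C E -> g (f E) = E.
  move=> CE; rewrite /g; case: xgetP => [E' _ [CE' fE]|/(_ E) []//].
  by apply: finj; rewrite ?inE.
pose W (s : set nat) := \bigcup_n ~` \bigcup_k g [set m | s (pickle (n : nat, k : nat, m))].
(* The default [set0] handles codes s for which [W s] is not meager. *)
exists (fun s => if pselect (meager C (W s)) then W s else set0); split.
  by move=> s; case: (pselect (meager C (W s))) => mWs //=; exact: meager0.
move=> S [F [sF ->]].
have /choice[e eP] n : exists e : nat -> set X, [/\ forall k, C (e k),
    F n `<=` ~` \bigcup_k e k & singular C (~` \bigcup_k e k)].
  have [D [Dr cD FD sD]] := singular_hull Cbase Cunc Cccc (sF n).
  (* An empty D would make the whole space singular, so there would be no region and [C] would have
     at most the empty set as a member. *)
  have D0 : D !=set0.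
    apply/set0P/eqP => D0; case: Cunc; suff -> : C = [set E | E = set0 /\ C E].
      by apply: (@sub_countable _ _ _ [set set0]); [apply: subset_card_le => E []|].
    apply/seteqP; split => [E CE|E []//]; split => //.
    apply: contrapT => /eqP/set0P E0.
    have [|B [[_ [x Bx]] _]] := sD E; first by [].
    by rewrite D0 bigcup_set0 setC0 setIT => B0; rewrite B0 in Bx.
  have [e De] := countable_range cD D0; exists e.
  have DE : \bigcup_(E in D) E = \bigcup_k e k by rewrite De bigcup_image.
  by rewrite -DE; split => // k; have [] : region C (e k) by apply: Dr; rewrite De; exists k.
pose s := [set p | exists n k m, p = pickle (n : nat, k : nat, m : nat) /\ f (e n k) m].
have Ws : W s = \bigcup_n ~` \bigcup_k e n k.
  apply: eq_bigcup => // n _; congr (~` _); apply: eq_bigcup => // k _.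
  rewrite -[RHS]gf; last by have [] := eP n.
  congr g; apply/seteqP; split => [m [n' [k' [m' [/(pcan_inj pickleK)]]]]|m fm].
    by case=> -> -> ->.
  by exists n, k, m.
exists s; case: (pselect (meager C (W s))) => [mWs|[]] /=; rewrite Ws.
  by apply: subset_bigcup => n _; have [] := eP n.
by apply: meager_bigcup_nat => n; apply: singular_meager; have [] := eP n.
Qed.

(** * Well-ordering with countable initial segments, and transfinite recursion *)

Lemma CH_well_order : CH -> exists lt : set nat -> set nat -> Prop,
  [/\ well_founded lt, forall s t, [\/ lt s t, s = t | lt t s],
      forall r s t, lt r s -> lt s t -> lt r t &
      forall s, countable [set t | lt t s]].
Proof.
move=> hCH; have [le wo] := well_ordering_principle (set nat).
have min (A : set (set nat)) : A !=set0 ->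
    exists2 s, A s & forall t, A t -> le s t.
  move=> [s0 As0]; have [|s [[/asboolP As sA] _]] := wo [pred s | `[< A s >]].
    by exists s0; apply/asboolP.
  by exists s => // t At; apply: sA; exact/asboolP.
(* The relation is only known to have unique minima on nonempty sets; the order axioms follow from
   sets of one, two or three elements. *)
have le_refl s : le s s by have [|t -> ] := min [set s]; [exists s|apply].
have le_total s t : le s t \/ le t s.
  have [|r [->|->] h] := min [set s; t]; first by exists s; left.
    by left; apply: h; right.
  by right; apply: h; left.
have le_anti s t : le s t -> le t s -> s = t.
  move=> st ts; have [|r [[rs _] uniq]] := wo [pred r | `[< r = s \/ r = t >]].
    by exists s; apply/asboolP; left.
  have <- : r = s.
    apply: uniq; split; first by apply/asboolP; left.
    by move=> u /asboolP[] ->.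
  apply: uniq; split; first by apply/asboolP; right.
  by move=> u /asboolP[] ->.
have le_trans r s t : le r s -> le s t -> le r t.
  move=> rs st; have [|u uE h] := min [set u | u = r \/ u = s \/ u = t].
    by exists r; left.
  case: uE h => [->|[->|->]] h; first by apply: h; right; right.
    by have -> : r = s by apply: le_anti => //; apply: h; left.
  by have <- : s = t by apply: le_anti => //; apply: h; right; left.
pose lt s t := le s t /\ s <> t.
have lt_trans r s t : lt r s -> lt s t -> lt r t.
  move=> [rs rNs] [st sNt]; split; first exact: le_trans st.
  by move=> rt; apply: rNs; apply: le_anti => //; rewrite rt.
have tricho s t : [\/ lt s t, s = t | lt t s].
  have [->|st] := pselect (s = t); first by constructor 2.
  have [?|?] := le_total s t; first by constructor 1.
  by constructor 3; split => // ts; exact: st.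
have wf : well_founded lt.
  move=> s; apply: contrapT => nAs.
  have [|t nAt h] := min [set t | ~ Acc lt t]; first by exists s.
  apply: nAt; constructor => r [rt rNt]; apply: contrapT => nAr.
  by apply: rNt; apply: le_anti => //; exact: h.
(* If all initial segments are countable, the identity works. Otherwise let z be least with an
   uncountable segment: by CH all sets of naturals inject into that segment, and the order pulled
   back along the injection has countable segments. *)
have [phi phi_inj phi_count] : exists2 phi : set nat -> set nat,
    injective phi & forall s, countable [set t | lt (phi t) (phi s)].
  have [[z zS zmin]|cS] := pselect (exists2 z,
      ~ countable [set t | lt t z] & forall s, ~ countable [set t | lt t s] -> le z s).
    have [//|] := hCH [set t | lt t z].
    rewrite card_eq_le => /andP[_ /pcard_leP/injfunPex[phi phi_lt phi_inj]].
    have {}phi_inj : injective phi by move=> s t; apply: phi_inj; rewrite inE.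
    exists phi => // s; apply: (@sub_countable _ _ _ [set t | lt t (phi s)]).
      have := inj_card_eq (in2W phi_inj : {in [set t | lt (phi t) (phi s)] &, _}).
      rewrite card_eq_le => /andP[_ /card_le_trans]; apply.
      by apply: subset_card_le => _ [t ? <-].
    apply: contrapT => /zmin zs; have [sz sNz] := phi_lt s Logic.I.
    exact/sNz/le_anti.
  exists id => // s; apply: contrapT => ncs; apply: cS.
  have [|z zS zmin] := min [set s | ~ countable [set t | lt t s]]; first by exists s.
  by exists z.
exists (fun s t => lt (phi s) (phi t)); split.
- move=> s; move: {2}(phi s) (erefl (phi s)) => u; move: u s.
  apply: (well_founded_ind wf) => u IH s su; constructor => t ts.
  by apply: (IH (phi t)) => //; rewrite -su.
- move=> s t; have [?|/phi_inj ?|?] := tricho (phi s) (phi t).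
  + by constructor 1.
  + by constructor 2.
  + by constructor 3.
- by move=> r s t; exact: lt_trans.
- exact: phi_count.
Qed.

(** A choice function F selects the next value from the index and the set of earlier values, so that
    [Fix] applies; that set is countable at every index. *)
Lemma well_founded_choice (I Y : Type) (lt : I -> I -> Prop)
    (Q : I -> set Y -> Y -> Prop) : well_founded lt ->
  (forall i, countable [set j | lt j i]) ->
  (forall i S, countable S -> exists y, Q i S y) ->
  exists f : I -> Y, forall i, Q i (f @` [set j | lt j i]) (f i).
Proof.
move=> wf clt exQ.
have /choice[F FP] : forall p : I * set Y, exists y,
    countable p.2 -> Q p.1 p.2 y.
  move=> [i S]; have [/(exQ i)[y Qy]|ncS] := pselect (countable S).
    by exists y.
  by have [y _] := exQ i set0 (countable0 _); exists y.
pose step i (rec : forall j, lt j i -> Y) :=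
  F (i, [set y | exists j (ji : lt j i), y = rec j ji]).
pose f := Fix wf (fun=> Y) step.
exists f => i; have fE : f i = F (i, f @` [set j | lt j i]).
  rewrite /f Fix_eq => [|j r1 r2 r12]; last first.
    by congr F; congr pair; apply/seteqP; split => y [k [kj ->]]; exists k, kj.
  congr F; congr pair; apply/seteqP; split => y.
    by move=> [j [ji ->]]; exists j.
  by move=> [j ji <-]; exists j, ji.
rewrite fE; apply: (FP (i, _)) => /=.
by apply: sub_countable (clt i); exact: card_image_le.
Qed.

(** * One stage of the construction, and the final sets *)

Section Construction.
Variables (R : realType) (X : topologicalLmodType R) (d : X -> X -> R).
Hypotheses (hd : is_metric d) (hcompat : metric_compatible d).
Hypothesis hsep : separable_space X.
Variable C : set (set X).
Hypotheses (hC : perfect_translation_base d C) (hlin : linearly_invariant C).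

(** The map x |-> p - x is an involution, composed of the dilation by -1 and a translation, so
    linear invariance makes it preserve [C]. *)
Lemma meager_reflect S p : meager C S -> meager C [set x | S (p - x)].
Proof.
move=> mS; pose f x := p - x.
have fK : cancel f f by move=> x; rewrite /f opprB addrC subrK.
have Cf E : C E -> C (f @` E).
  move=> CE; suff -> : f @` E = translate (dilate (-1) E) p.
    by apply: hlin.1; apply: hlin.2 => //; rewrite oppr_eq0 oner_eq0.
  rewrite /translate /dilate image_comp; congr image; apply/funext => x.
  by rewrite /= scaleN1r addrC.
apply: meager_sub (meager_image fK fK Cf Cf mS) => x Sx.
by exists (f x) => //; rewrite fK.
Qed.

Lemma meager_avoid S : meager C S -> exists x, ~ S x.
Proof.
move=> mS; apply: contrapT => noX.
have [A [rA _ _]] := region_at hd hcompat hC (@filterT _ (nbhs (0 : X)) _).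
apply: (region_abundant hsep hC rA); apply: meager_sub mS => x _.
by apply: contrapT => nSx; apply: noX; exists x.
Qed.

(* A triple (t, t', z) records the points added to T, to T' and to the complement
   of T + T' at one stage; S is the set of the earlier triples. *)
Lemma extension_step (S : set (X * X * X)) (P M : set X) :
  ~ countable P -> meager C M -> countable S ->
  exists y : X * X * X,
    [/\ P (y.1.1 + y.1.2), P y.2, ~ M y.1.1, ~ M y.1.2 &
      forall a b c, S a \/ a = y -> S b \/ b = y -> S c \/ c = y ->
        [/\ S a, S b & S c] \/ a.1.1 + b.1.2 <> c.2].
Proof.
move=> ncP mM cS.
have avoid (N : set X) : countable N -> exists2 x, P x & ~ N x.
  move=> cN; apply: contrapT => noX; apply: ncP; apply: sub_countable cN.
  apply: subset_card_le => x Px; apply: contrapT => nNx.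
  by apply: noX; exists x.
have cS2 (f : (X * X * X) * (X * X * X) -> X) : countable (f @` (S `*` S)).
  by apply: sub_countable (card_image_le _ _) _; exact: countableX.
have cS1 (f : X * X * X -> X) : countable (f @` S).
  exact: sub_countable (card_image_le _ _) cS.
(* The order of choice is p, t, z: p avoids the earlier z; then t and p - t avoid M and all
   differences that would hit an earlier z; finally z avoids every sum, including p. *)
have [p Pp pS] := avoid _ (cS1 (fun c => c.2)).
have mcount N : countable N -> meager C N.
  exact: (base_countable_meager hd hcompat hsep hC).
pose N1 := M `|` (fun bc => bc.2.2 - bc.1.1.2) @` (S `*` S).
pose N2 := M `|` (fun ac => ac.2.2 - ac.1.1.1) @` (S `*` S).
have [t] : exists t, ~ (N1 `|` [set x | N2 (p - x)]) t.
  apply: meager_avoid; apply: meagerU; last apply: meager_reflect;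
    by apply: meagerU => //; apply: mcount; exact: cS2.
move=> /not_orP[/not_orP[tM tS] /not_orP[t'M t'S]].
pose N := ((fun ab => ab.1.1.1 + ab.2.1.2) @` (S `*` S) `|`
  ((fun b => t + b.1.2) @` S `|` ((fun a => a.1.1 + (p - t)) @` S `|` [set p]))).
have [z Pz zN] : exists2 z, P z & ~ N z.
  apply: avoid; apply: countableU; first exact: cS2.
  by do 2?[apply: countableU; first exact: cS1]; exact: countable1.
move: zN => /not_orP[zab /not_orP[zb /not_orP[za zp]]].
have pE : t + (p - t) = p by rewrite addrC subrK.
exists (t, p - t, z); split => //=; first by rewrite pE.
move=> a b c [Sa|->] [Sb|->] [Sc|->] /=.
- by left.
- by right => abz; apply: zab; exists (a, b).
- by right => ac; apply: t'S; exists (a, c) => //=; rewrite -ac addrC addKr.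
- by right => az; apply: za; exists a.
- by right => bc; apply: tS; exists (b, c) => //=; rewrite -bc addrK.
- by right => bz; apply: zb; exists b.
- by right; rewrite pE => pc; apply: pS; exists c.
- by right; rewrite pE => pz; apply: zp.
Qed.

End Construction.

Theorem theorem2p10 (R : realType) (X : topologicalLmodType R) (d : X -> X -> R)
    (hd : is_metric d) (hcompat : metric_compatible d) (hcompl : metric_complete d)
    (hsep : separable_space X) (hCH : CH) (C : set (set X))
    (hC : perfect_translation_base d C) (hccc : ccc C)
    (hlin : linearly_invariant C) (hcard : card_le C [set: set nat]) :
  exists T T' : set X,
    [/\ rare C T /\ rare C T',
        bernstein (setsum T T') &
        forall D : set (set X), perfect_translation_base d D ->
          ~ equivalent_bases C D -> meager D T /\ meager D T'].
Proof.
have Cbase : category_base C by have [[]] := hC.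
have Cunc := base_uncountable hd hcompat hC.
have [M [mM Mcof]] := meager_coding Cbase Cunc hccc hcard.
have [g gP] := closed_coding hd hcompat hsep.
have [lt [wf tricho lt_trans seg]] := CH_well_order hCH.
have Xunc : ~ countable [set: X].
  have [A [rA A0 _]] := region_at hd hcompat hC (@filterT _ (nbhs (0 : X)) _).
  have [[_ [reg_perfect _]] _] := hC.
  have : ~ countable A.
    by apply: (perfect_uncountable hd hcompat hcompl); [exists 0|exact: reg_perfect].
  by apply: contra_not; apply: sub_countable; exact: card_leT.
(* Indices that code no nonempty perfect set get the whole space, which is uncountable too, so every
   stage can be carried out. *)
pose P i := if pselect (g i !=set0 /\ perfect_set (g i)) then g i else setT.
have Punc i : ~ countable (P i).
  rewrite /P; case: (pselect (g i !=set0 /\ perfect_set (g i))) => //= -[gi0 gip].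
  exact: (perfect_uncountable hd hcompat hcompl).
have PP Q : Q !=set0 -> perfect_set Q -> exists i, P i = Q.
  move=> Q0 Qp; have [i giQ] := gP Q Qp.1; exists i.
  by rewrite /P giQ; case: (pselect (Q !=set0 /\ perfect_set Q)) => // -[].
pose le i j := lt i j \/ i = j.
pose ML i := \bigcup_(j in [set j | le j i]) M j.
have mML i : meager C (ML i).
  apply: meager_bigcup => [|j _]; last exact: mM.
  suff -> : [set j | le j i] = [set j | lt j i] `|` [set i].
    by apply: countableU => //; exact: countable1.
  by apply/seteqP; split => j [?|?]; [left|right|left|right].
have [f fP] := well_founded_choice wf seg
  (fun i S cS => extension_step hd hcompat hsep hC hlin (Punc i) (mML i) cS).
pose t i := (f i).1.1; pose t' i := (f i).1.2.
have fle m i : le i m -> (f @` [set j | lt j m]) (f i) \/ f i = f m.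
  by move=> [im|->]; [left; exists i|right].
have lt_leN i j : ~ le j i -> lt i j.
  by move=> nji; have [//|ij|ji] := tricho i j; case: nji; [right|left].
have max2 i j : exists2 m, (m = i \/ m = j) & le i m /\ le j m.
  have [ij|ij|ji] := tricho i j.
  - by exists j; [right|split; [left|right]].
  - by exists j; [right|split; right].
  - by exists i; [left|split; [right|left]].
have le_trans a b c : le a b -> le b c -> le a c.
  by move=> [ab|->] [bc|<-]; [left; exact: lt_trans bc|left|left|right].
(* Induction on a common bound m. The stage m condition either excludes the equality or shows that
   all three triples occur as values at indices below m; the largest of these indices is the smaller
   bound. *)
have avoid m i j k : le i m -> le j m -> le k m -> t i + t' j <> (f k).2.
  move: m i j k; apply: (well_founded_ind wf) => m IH i j k im jm km.
  have [_ _ _ _ h] := fP m.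
  have [[[i1 /= i1m fi] [j1 /= j1m fj] [k1 /= k1m fk]]|//] :=
    h _ _ _ (fle _ _ im) (fle _ _ jm) (fle _ _ km).
  rewrite /t /t' -fi -fj -fk.
  have [n1 n1E [in1 jn1]] := max2 i1 j1; have [n nE [n1n kn]] := max2 n1 k1.
  have nm : lt n m by case: nE => ->//; case: n1E => ->.
  exact: (IH n nm i1 j1 k1 (le_trans _ _ _ in1 n1n) (le_trans _ _ _ jn1 n1n) kn).
(* A meager set lies in some [M j], which [u i] avoids unless i precedes j. A countable range would
   itself lie in some [M i], although [u i] does not. *)
have rare_range (u : set nat -> X) : (forall i, ~ ML i (u i)) -> rare C (range u).
  move=> uP; have uM i j : M j (u i) -> lt i j.
    by move=> Mj; apply: lt_leN => ji; apply: (uP i); exists j.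
  split => [|S /Mcof[j SM]]; last first.
    apply: (@sub_countable _ _ _ (u @` [set i | lt i j])).
      apply: subset_card_le => _ [[i _ <-] /SM Mi].
      by exists i => //; exact: uM.
    exact: sub_countable (card_image_le _ _) (seg j).
  move=> /(base_countable_meager hd hcompat hsep hC)/Mcof[i uMi].
  by apply: (uP i); exists i; [right|apply: uMi; exists i].
exists (range t), (range t'); have rT : rare C (range t).
  by apply: rare_range => i; have [] := fP i.
have rT' : rare C (range t') by apply: rare_range => i; have [] := fP i.
split => //.
- move=> Q Q0 Qp; have [i <-] := PP Q Q0 Qp; have [Pt Pz _ _ _] := fP i; split.
    exists (t i + t' i); split => //; exists (t i); first by exists i.
    by exists (t' i) => //; exists i.
  exists (f i).2; split => // -[_ [j _ <-] [_ [k _ <-]]].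
  have [n1 _ [jn1 kn1]] := max2 j k; have [n _ [n1n kn]] := max2 n1 i.
  by apply: (avoid n) => //; [exact: le_trans n1n|exact: le_trans n1n].
- move=> D hD nCD.
  have [N [mN mDN]] := nonequivalent_orthogonal hd hcompat hsep hC hD hccc nCD.
  have rare_meager T : rare C T -> meager D T.
    move=> [_ /(_ N mN) cTN]; apply: (@meager_sub _ _ _ ((T `&` N) `|` ~` N)).
      by move=> x Tx; have [Nx|] := pselect (N x); [left|right].
    by apply: meagerU => //; exact: (base_countable_meager hd hcompat hsep hD).
  by split; exact: rare_meager.
Qed.
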